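(* Let $n \ge 4$ and let $f : [1,\infty) \to \mathbb{R}$ be a concave function. Then for every unicyclic graph $G$ with $n$ vertices, $$ f(n-1) + 2 f(2) + (n-3) f(1) \le I_f(G) \le n f(2), $$ and both inequalities are attained (i.e., for each such $n$ and $f$, each of the two bounds is equal to $I_f(G)$ for some unicyclic graph $G$ with $n$ vertices).
   Context: All graphs are finite, connected, simple (no loops, no multiple edges) and have at least one edge. A unicyclic graph is a graph containing exactly one cycle. For a vertex $u$ of $G$, $d_u$ denotes its degree. For a function $f:[1,\infty)\to\mathbb{R}$, $I_f(G) = \sum_{u\in V(G)} f(d_u)$. *)

(* Defs.v *)
From mathcomp Require Import all_boot all_order all_algebra.
From mathcomp Require Import all_classical all_reals all_analysis.

Set Implicit Arguments.
Unset Strict Implicit.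
Unset Printing Implicit Defensive.

Import Order.TTheory GRing.Theory Num.Theory.

Local Open Scope classical_set_scope.
Local Open Scope ring_scope.

Record graph := Graph {
  vertex : finType;
  adj : rel vertex;
  adj_sym : symmetric adj;
  adj_irr : irreflexive adj;
  adj_conn : forall u v, connect adj u v;
  adj_edge : exists u v, adj u v }.

Definition degree (G : graph) (u : vertex G) : nat :=
  #|[set v | @adj G u v]%SET|.

(* A cycle is a subgraph, so it is represented by its set of edges: cyclic
   vertex sequences that differ by a rotation or a reversal give the same
   cycle. *)
Definition is_cycle (G : graph) (C : {set {set vertex G}}) : Prop :=
  exists c : seq (vertex G),
    [/\ ucycle (@adj G) c, (3 <= size c)%N &
        C = [set [set x; next c x] | x in c]%SET].

Definition unicyclic (G : graph) : Prop :=
  exists! C : {set {set vertex G}}, is_cycle C.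

(* Only the values of f on [1, +oo[ matter, degrees being positive. *)
Definition degree_index (R : realType) (f : R -> R) (G : graph) : R :=
  \sum_(u : vertex G) f (degree u)%:R.

Definition concave_on (R : realType) (D : set R) (f : R -> R) : Prop :=
  @convex_function R R^o D (fun x => - f x).

(* Main.v *)
(** Orient every edge of a unicyclic graph towards its cycle, and the cycle
    itself cyclically.  Each vertex [u] gets one outgoing edge [{u, p u}], and
    there are no other edges, since another edge together with a path in the
    spanning tree given by [p] would form a second cycle.  So the degrees sum to
    [2n].  As [f] is concave, [f] lies below the line through its values at 1 and
    2 at every degree, and summing gives the upper bound.  For the lower bound,
    let [s] be the slope of [f] between 2 and [n - 1]; then
    [f k >= f 1 + (k - 1) s + [k >= 2] (f 2 - f 1 - s)] for [1 <= k <= n - 1],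
    and at least three vertices, those of the cycle, have degree at least 2. *)

Require Import Defs.
From mathcomp Require Import all_boot all_order all_algebra.
From mathcomp Require Import all_classical all_reals all_analysis.
From mathcomp Require Import ring lra zify.

Import Order.TTheory GRing.Theory Num.Theory.

Set Implicit Arguments.
Unset Strict Implicit.
Unset Printing Implicit Defensive.

(** * Degrees in unicyclic graphs *)

(** Once [c] is rotated to start at [x], two steps lead to its third entry, which is not [x] as [c]
    has no repetition. *)
Lemma next_next_neq (T : eqType) (c : seq T) (x : T) :
  uniq c -> 2 < size c -> x \in c -> next c (next c x) != x.
Proof.
move=> Uc sc xc; have [i s def_c] := rot_to xc.
have Us : uniq (x :: s) by rewrite -def_c rot_uniq.
have sz : size (x :: s) = size c by rewrite -def_c size_rot.
rewrite -!(next_rot i Uc) def_c; move: Us; rewrite -sz in sc.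
case: s sc {def_c sz} => [|a [|b s]] //= _; rewrite !inE !negb_or !eqxx.
by case/and3P=> /and3P[xa xb _] _ _; rewrite [a == x]eq_sym (negPf xa) ?eqxx eq_sym.
Qed.

Lemma prev_neq_next (T : eqType) (c : seq T) (x : T) :
  uniq c -> 2 < size c -> x \in c -> prev c x != next c x.
Proof.
move=> Uc sc xc; apply/negP => /eqP e.
by have := next_next_neq Uc sc xc; rewrite -e next_prev ?eqxx.
Qed.

Lemma ucycle_degree_ge2 (G : graph) (c : seq (vertex G)) (x : vertex G) :
  ucycle (@adj G) c -> 2 < size c -> x \in c -> 2 <= degree x.
Proof.
case/andP=> Ec Uc sc xc; have nx := prev_neq_next Uc sc xc.
have <- : #|[set prev c x; next c x]%SET| = 2 by rewrite cards2 nx.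
apply/subset_leq_card/fintype.subsetP => y; rewrite !inE.
case/orP=> /eqP->; last exact: next_cycle.
by rewrite adj_sym; exact: prev_cycle.
Qed.

Lemma card_unicyclic_degree_ge2 (G : graph) :
  unicyclic G -> 3 <= #|[set u : vertex G | 2 <= degree u]%SET|.
Proof.
case=> C [[c [Ec sc _]] _]; have Uc : uniq c by case/andP: Ec.
apply: (leq_trans sc); rewrite -(card_uniqP Uc).
apply/subset_leq_card/fintype.subsetP => x xc; rewrite inE.
exact: (ucycle_degree_ge2 Ec sc xc).
Qed.

(** [h u] is the distance from [u] to [S], and [p u] a neighbour of [u] nearer to [S]. With [S] the
    vertex set of the cycle, this orients the remaining edges towards it. *)
Lemma exists_parent (G : graph) (S : {set vertex G}) (r : vertex G) :
  r \in S -> exists (h : vertex G -> nat) (p : vertex G -> vertex G),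
    forall u, u \notin S -> adj u (p u) /\ h (p u) < h u.
Proof.
move=> rS.
pose P u m := [exists t : m.-tuple (vertex G), path (@adj G) u t && (last u t \in S)].
have E u : exists m, P u m.
  have /connectP[t pt lt] := adj_conn u r.
  by exists (size t); apply/existsP; exists (in_tuple t); rewrite pt -lt.
pose h u := ex_minn (E u).
(* Outside [S] the default [u] is never taken: the second vertex of a shortest path into [S]
   qualifies. *)
pose p u := odflt u [pick v | adj u v && (h v < h u)].
exists h, p => u uS; rewrite /p; case: pickP => [v /andP[]//|no_v]; exfalso.
move: no_v; rewrite {2}/h; case: ex_minnP => -[|m] /existsP[[t /= st]] /andP[pt lt] _.
  by case: t st pt lt => //= _ _ uS'; rewrite uS' in uS.
case: t st pt lt => //= v t /eqP[/eqP st] /andP[uv pt] lt /(_ v).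
rewrite uv /= ltnS /h; case: ex_minnP => k _ kmin; rewrite kmin //.
by apply/existsP; exists (Tuple st); rewrite pt.
Qed.

(** The neighbours of [u] are [p u] and the preimages of [u]; these do not overlap, because
    [p (p u) != u]. Each vertex is a preimage of exactly one vertex, so both kinds contribute
    [#|vertex G|] to the sum. *)
Lemma sum_degree_functional (G : graph) (p : vertex G -> vertex G) :
  (forall u, p (p u) != u) ->
  (forall u v, adj u v = (v == p u) || (u == p v)) ->
  \sum_(u : vertex G) degree u = (#|vertex G|).*2.
Proof.
move=> pp adjE.
have dE u : degree u = 1 + \sum_v (u == p v).
  rewrite /degree -sum1dep_card (bigD1 (p u)) ?adjE ?eqxx //=; congr (_ + _).
  rewrite big_mkcond [RHS](bigID (fun v => v == p u)) /=.
  rewrite big_pred1_eq [u == _]eq_sym (negPf (pp u)) add0n.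
  rewrite [RHS]big_mkcond; apply: eq_bigr => v _.
  by rewrite adjE; case: eqP => //= _; rewrite andbT; case: (u == p v).
rewrite (eq_bigr _ (fun u _ => dE u)) big_split /= exchange_big /= -addnn.
congr (_ + _); first by rewrite sum1_card.
rewrite -sum1_card; apply: eq_bigr => v _.
by rewrite (bigD1 (p v)) //= eqxx big1 ?addn0 // => u /negPf->.
Qed.

Lemma fconnect_next (T : finType) (c : seq T) (x y : T) :
  uniq c -> x \in c -> y \in c -> fconnect (next c) x y.
Proof.
by move=> Uc xc yc; rewrite fconnect_orbit (in_orbit_cycle (cycle_next Uc) xc).
Qed.

Lemma unicyclic_functional (G : graph) : unicyclic G ->
  exists p : vertex G -> vertex G, (forall u, p (p u) != u) /\
    (forall u v, adj u v = (v == p u) || (u == p v)).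
Proof.
case=> C [[c [Ec sc defC]] C_uniq].
have [cyc Uc] := andP Ec.
have [r rc] : exists r, r \in c.
  by case: c sc {Ec defC cyc Uc} => // r s _; exists r; rewrite mem_head.
have rS : r \in [set x in c]%SET by rewrite inE.
have [h [q hq]] := exists_parent rS.
pose p u := if u \in c then next c u else q u.
have p_c u : u \in c -> p u = next c u by rewrite /p => ->.
have p_out u : u \notin c -> adj u (p u) /\ (h (p u) < h u)%N.
  by move=> uc; have := hq u; rewrite inE /p (negPf uc); apply.
have adj_p u : adj u (p u).
  have [uc|/p_out[]//] := boolP (u \in c).
  by rewrite p_c //; exact: next_cycle.
(* On [c] two steps of [next] do not return; from outside, [p] either enters [c] and stays there, or
   lowers [h] twice. *)
have pp u : p (p u) != u.
  have [uc|uc] := boolP (u \in c).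
    by rewrite p_c // p_c ?mem_next //; exact: next_next_neq.
  have [puc|puc] := boolP (p u \in c).
    by rewrite [p (p u)]p_c //; apply: contraNneq uc => <-; rewrite mem_next.
  have [_ h1] := p_out _ uc; have [_ h2] := p_out _ puc.
  by apply/eqP => ppu; have := ltn_trans h2 h1; rewrite ppu ltnn.
exists p; split=> // x y.
apply/idP/orP => [xy|[]/eqP->]; [|exact: adj_p|by rewrite adj_sym adj_p].
apply/orP; apply/negPn/negP; rewrite negb_or => /andP[ypx xpy].
(* [e] drops the edge from [r] to [p r], which leaves a spanning tree. *)
pose e u v := (u != r) && (v == p u) || (v != r) && (u == p v).
have e_sym : symmetric e by move=> u v; rewrite /e orbC.
have e_adj u v : e u v -> adj u v.
  by case/orP=> /andP[_ /eqP->] //; rewrite adj_sym.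
have e_p u : u != r -> e u (p u) by rewrite /e eqxx => ->.
(* Following [next c] up to the first visit of [r] never uses the dropped edge. *)
have to_root_c u : u \in c -> connect e u r.
  move=> uc; have := iter_findex (fconnect_next Uc uc rc).
  move: (findex _ _ _) => m; elim: m u uc => [|m IHm] u uc; first by move=> /= ->.
  have [->|ur] := eqVneq u r; first by rewrite connect0.
  rewrite iterSr => /IHm; rewrite mem_next => /(_ uc).
  by apply: connect_trans; rewrite -p_c //; apply: connect1; exact: e_p.
(* Outside [c], following [p] lowers [h], so [c] is eventually reached. *)
have to_root u : connect e u r.
  have [m] := ubnP (h u); elim: m u => // m IHm u hu.
  have [|uc] := boolP (u \in c); first exact: to_root_c.
  have [_ hp] := p_out _ uc.
  have ur : u != r by apply: contraNneq uc => ->.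
  apply: connect_trans (connect1 (e_p _ ur)) (IHm _ _).
  exact: leq_trans hp _.
(* A simple tree path from [y] to [x], closed by the extra edge, is a cycle. *)
have : connect e y x.
  by apply: connect_trans (to_root y) _; rewrite (sym_connect_sym e_sym).
case/connectP => t0 /shortenP[t et Ut _] lt.
have Eyt : ucycle (@adj G) (y :: t).
  rewrite /ucycle Ut andbT /= rcons_path -lt xy andbT.
  by apply: sub_path et => u v; exact: e_adj.
(* A shorter path would make [x] and [y] equal, or adjacent in the tree, against the choice of the
   edge. *)
have st : 2 < size (y :: t).
  case: t et lt {Ut Eyt} => [_ /= yx|z [|? ?]] //=.
    by rewrite yx adj_irr in xy.
  rewrite andbT => eyz xz; move: eyz; rewrite -xz /e.
  by rewrite (negPf ypx) (negPf xpy) !andbF.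
have : [set x; y]%SET \in C.
  rewrite (C_uniq _ (ex_intro _ _ (And3 Eyt st erefl))).
  apply/imsetP; exists x; first by rewrite lt mem_last.
  congr [set x; _]%SET.
  (* [x] is the last entry, so the lookup runs past the end of [t] and yields its default, the head
     [y]. *)
  by rewrite next_nth lt mem_last index_last // nth_default.
(* As an edge of [c], the pair has the form [{z, p z}], which was excluded. *)
rewrite defC => /imsetP[z zc]; rewrite -p_c // => /setP e2.
have xny : x != y by apply: contraTneq xy => ->; rewrite adj_irr.
have := e2 x; have := e2 y; rewrite !inE !eqxx orbT /=.
move=> /esym/orP[]/eqP yE /esym/orP[]/eqP xE; move: xny ypx xpy;
  by rewrite xE yE ?eqxx.
Qed.

Lemma unicyclic_sum_degree (G : graph) :
  unicyclic G -> \sum_(u : vertex G) degree u = (#|vertex G|).*2.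
Proof. by case/unicyclic_functional=> p [pp adjE]; exact: (sum_degree_functional pp). Qed.

Lemma degree_lt_card (G : graph) (u : vertex G) : degree u < #|vertex G|.
Proof.
rewrite /degree -cardsT; apply: proper_card; apply/properP; split.
  exact: finset.subsetT.
by exists u; rewrite !inE ?adj_irr.
Qed.

Lemma degree_gt0 (G : graph) (u : vertex G) : 0 < degree u.
Proof.
have [a [b ab]] := adj_edge G.
have [v uv] : exists v, u != v.
  have [e|] := eqVneq u a; last by exists a.
  by exists b; rewrite e; apply: contraTneq ab => ->; rewrite adj_irr.
have /connectP[[|w t] /=] := adj_conn u v; first by move=> _ /eqP; rewrite eq_sym (negPf uv).
by case/andP=> uw _ _; apply/card_gt0P; exists w; rewrite inE.
Qed.

(** * Extremal graphs *)

(** A criterion for the extremal graphs. Vertices outside [c0] have too small a degree to lie on a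
    cycle, and on any cycle the two cyclic neighbours of a vertex exhaust its neighbours in [c0].
    Hence every cycle uses all edges among the vertices of [c0]. *)
Lemma unicyclic_of_degree_le2 (G : graph) (c0 : seq (vertex G)) :
  ucycle (@adj G) c0 -> 3 <= size c0 ->
  (forall x, x \in c0 -> #|[set y in c0 | adj x y]%SET| <= 2) ->
  (forall x, x \notin c0 -> degree x <= 1) ->
  unicyclic G.
Proof.
move=> E0 s0 d2 d1; have /andP[cyc0 U0] := E0.
have sub c : ucycle (@adj G) c -> 2 < size c -> {subset c <= c0}.
  move=> Ec sc x xc; apply: contraLR (ucycle_degree_ge2 Ec sc xc) => /d1.
  by rewrite -ltnNge.
have nbr c x y : ucycle (@adj G) c -> 2 < size c -> x \in c ->
    y \in c0 -> adj x y -> (y == prev c x) || (y == next c x).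
  move=> Ec sc xc yc xy; have [cyc Uc] := andP Ec.
  have /eqP/setP/(_ y) : [set prev c x; next c x]%SET == [set y in c0 | adj x y]%SET.
    rewrite eqEcard cards2 prev_neq_next // (d2 x (sub c Ec sc x xc)) andbT.
    apply/fintype.subsetP => z; rewrite !inE => /orP[]/eqP->.
      by rewrite (sub c) ?mem_prev // adj_sym prev_cycle.
    by rewrite (sub c) ?mem_next // next_cycle.
  by rewrite !inE yc xy.
(* [c] is stable under [next c0], whose iterates reach all of [c0]. *)
have closed c : ucycle (@adj G) c -> 2 < size c -> c =i c0.
  move=> Ec sc y; apply/idP/idP => [|yc]; first exact: sub.
  have [x xc] : exists x, x \in c.
    by case: c sc {Ec} => // x s _; exists x; rewrite mem_head.
  rewrite -(iter_findex (fconnect_next U0 (sub c Ec sc x xc) yc)).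
  elim: (findex _ _ _) => //= m IHm; set z := iter _ _ _ in IHm *.
  have zc := sub c Ec sc z IHm.
  have /(nbr c z _ Ec sc IHm) : next c0 z \in c0 by rewrite mem_next.
  by move/(_ (next_cycle cyc0 zc)) => /orP[]/eqP->; rewrite (mem_prev, mem_next).
(* The right-hand side does not depend on [c], which gives uniqueness. *)
have edges c : ucycle (@adj G) c -> 2 < size c ->
    [set [set x; next c x] | x in c]%SET =
    [set e : {set vertex G} |
      [exists x in c0, exists y in c0, adj x y && (e == [set x; y]%SET)]]%SET.
  move=> Ec sc; have [cyc Uc] := andP Ec.
  apply/setP => e; rewrite inE; apply/imsetP/existsP => [[x xc ->]|].
    exists x; rewrite -(closed c) // xc /=; apply/existsP; exists (next c x).
    by rewrite -(closed c) // mem_next xc next_cycle /=.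
  move=> [x /andP[xc /existsP[y /andP[yc /andP[xy /eqP->]]]]].
  have xc' : x \in c by rewrite closed.
  have /orP[/eqP->|/eqP->] := nbr c x y Ec sc xc' yc xy; last by exists x.
  by exists (prev c x); rewrite ?mem_prev // next_prev // finset.setUC.
exists [set [set x; next c0 x] | x in c0]%SET; split; first by exists c0.
by move=> C [c [Ec sc ->]]; rewrite !edges.
Qed.

Definition cycle_adj m : rel 'I_m.+3 :=
  fun i j => (j == ordS i) || (i == ordS j).

Lemma cycle_adj_sym m : symmetric (@cycle_adj m).
Proof. by move=> i j; rewrite /cycle_adj orbC. Qed.

Lemma cycle_adj_irr m : irreflexive (@cycle_adj m).
Proof.
move=> i; rewrite /cycle_adj orbb -val_eqE /=; have := ltn_ord i.
rewrite ltnS leq_eqVlt => /predU1P[->|lt]; first by rewrite modnn.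
by rewrite modn_small ?ltnS // ltn_eqF.
Qed.

Lemma fconnect_ordS0 n (i : 'I_n.+1) : fconnect (@ordS n.+1) ord0 i.
Proof.
suff -> : i = iter i (@ordS n.+1) ord0 by exact: fconnect_iter.
apply/val_inj; case: i => i /=; elim: i => //= i IHi lt.
by rewrite -IHi ?(ltnW lt) // modn_small.
Qed.

Lemma cycle_adj_conn m (i j : 'I_m.+3) : connect (@cycle_adj m) i j.
Proof.
have to0 k : connect (@cycle_adj m) ord0 k.
  apply: connect_sub (fconnect_ordS0 k) => u v /eqP <-.
  by apply: connect1; rewrite /cycle_adj eqxx.
apply: connect_trans (to0 j).
by rewrite (sym_connect_sym (@cycle_adj_sym m)).
Qed.

Lemma cycle_adj_edge m : exists i j : 'I_m.+3, cycle_adj i j.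
Proof. by exists ord0, (ordS ord0); rewrite /cycle_adj eqxx. Qed.

Definition cycle_graph m : graph :=
  Graph (@cycle_adj_sym m) (@cycle_adj_irr m) (@cycle_adj_conn m) (cycle_adj_edge m).

(** [2] is not [0] modulo [m + 3]. *)
Lemma ordS_ordS_neq m (i : 'I_m.+3) : ordS (ordS i) != i.
Proof.
rewrite -val_eqE /= -[(_ %% _).+1]addn1 modnDml addn1 -addn2.
rewrite -{2}(modn_small (ltn_ord i)) -{2}[val i]addn0 eqn_modDl.
by rewrite mod0n modn_small.
Qed.

Lemma degree_cycle_graph m (i : vertex (cycle_graph m)) : degree i = 2.
Proof.
rewrite /degree (_ : [set _ | _]%SET = [set ordS i; ord_pred i]%SET).
  rewrite cards2 -(can_eq (@ordSK _)) ord_predK.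
  by rewrite ordS_ordS_neq.
apply/setP => j; rewrite !inE /= /cycle_adj; congr (_ || _).
by rewrite [i == _]eq_sym (can2_eq (@ordSK _) (@ord_predK _)).
Qed.

(** The orbit of [0] under [ordS] is a cycle through all vertices, each of degree 2. *)
Lemma unicyclic_cycle_graph m : unicyclic (cycle_graph m).
Proof.
have all_in (i : 'I_m.+3) : i \in orbit (@ordS m.+3) ord0.
  by rewrite -fconnect_orbit fconnect_ordS0.
have Uo := orbit_uniq (@ordS m.+3) ord0.
apply: (@unicyclic_of_degree_le2 (cycle_graph m) (orbit (@ordS m.+3) ord0)).
- rewrite /ucycle Uo andbT /=.
  apply: sub_cycle (cycle_orbit (@ordS_inj _) ord0) => i j /eqP<-.
  by rewrite /cycle_adj eqxx.
- rewrite -(card_uniqP Uo) (eq_card (B := predT)) ?card_ord //.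
- move=> i _; rewrite -(degree_cycle_graph i).
  by apply/subset_leq_card/fintype.subsetP => j; rewrite !inE => /andP[].
by move=> i; rewrite all_in.
Qed.

(* Only [1] and [2] are distinct nonzero naturals with sum [3], so this is the
   star centred at [0] together with the edge [{1, 2}]. *)
Definition star_edge_adj m : rel 'I_m.+3 :=
  fun i j => (i != j) && [|| val i == 0, val j == 0 | val i + val j == 3].

Lemma star_edge_adj_sym m : symmetric (@star_edge_adj m).
Proof. by move=> i j; rewrite /star_edge_adj eq_sym orbCA addnC. Qed.

Lemma star_edge_adj_irr m : irreflexive (@star_edge_adj m).
Proof. by move=> i; rewrite /star_edge_adj eqxx. Qed.

Lemma star_edge_adj_conn m (i j : 'I_m.+3) : connect (@star_edge_adj m) i j.
Proof.
have to0 k : connect (@star_edge_adj m) ord0 k.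
  have [<-|k0] := eqVneq ord0 k; first exact: connect0.
  by apply: connect1; rewrite /star_edge_adj k0.
apply: connect_trans (to0 j).
by rewrite (sym_connect_sym (@star_edge_adj_sym m)).
Qed.

Lemma star_edge_adj_edge m : exists i j : 'I_m.+3, star_edge_adj i j.
Proof. by exists ord0, (lift ord0 ord0). Qed.

Definition star_edge_graph m : graph :=
  Graph (@star_edge_adj_sym m) (@star_edge_adj_irr m) (@star_edge_adj_conn m)
    (star_edge_adj_edge m).

Lemma degree_star_edge_graph m (i : 'I_m.+3) :
  @degree (star_edge_graph m) i = if val i == 0 then m.+2 else if val i < 3 then 2 else 1.
Proof.
rewrite /degree; case: ifPn => [i0|i0].
  rewrite (_ : [set _ | _]%SET = [set~ i]%SET) ?cardsC1 ?card_ord //.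
  by apply/setP => j; rewrite !inE /= /star_edge_adj i0 andbT eq_sym.
case: ifPn => [i3|i3].
  (* For [i] equal to 1 or 2, [3 - i] is the other end of the extra edge. *)
  have lt : 3 - val i < m.+3 by move: (val i) i0 => a; lia.
  rewrite (_ : [set _ | _]%SET = [set ord0; Ordinal lt]%SET).
    by rewrite cards2 -val_eqE /= eq_sym subn_eq0 leqNgt i3.
  apply/setP => j; rewrite !inE /= /star_edge_adj -!val_eqE /=.
  by move: i0 i3 => /=; move: (nat_of_ord i) (nat_of_ord j) => a b; lia.
rewrite (_ : [set _ | _]%SET = [set ord0]%SET) ?cards1 //.
apply/setP => j; rewrite !inE /= /star_edge_adj -!val_eqE /=.
by move: i0 i3 => /=; move: (nat_of_ord i) (nat_of_ord j) => a b; lia.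
Qed.

(** The cycle is the triangle on [0], [1], [2]; all other vertices are leaves. *)
Lemma unicyclic_star_edge_graph m : unicyclic (star_edge_graph m).
Proof.
pose i1 : 'I_m.+3 := lift ord0 ord0.
pose i2 : 'I_m.+3 := lift ord0 (lift ord0 ord0).
have inE3 (i : 'I_m.+3) : (i \in [:: ord0; i1; i2]) = (val i < 3).
  by rewrite !inE -!val_eqE /=; case: i => -[|[|[|]]].
apply: (@unicyclic_of_degree_le2 (star_edge_graph m) [:: ord0; i1; i2]) => //.
- move=> x xc.
  apply: (@leq_trans #|[set y in [:: ord0; i1; i2]] :\ x|%SET).
    apply/subset_leq_card/fintype.subsetP => y; rewrite !in_setD1 !inE.
    by case/andP=> -> /andP[]; rewrite eq_sym => ->.
  rewrite -ltnS; apply: leq_trans (proper_card (properD1 _)) _.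
    by rewrite inE.
  by rewrite cardsE; exact: card_size.
- move=> x; rewrite inE3 => x3; rewrite degree_star_edge_graph (negPf x3).
  by case: eqP x3 => // ->.
Qed.

Local Open Scope classical_set_scope.
Local Open Scope ring_scope.

(** * Concavity bounds *)

(** Concavity with denominators cleared: [y] is the combination of [x] and [z] with weights
    [(z - y) / (z - x)] and [(y - x) / (z - x)]. *)
Lemma concave_on_chord (R : realType) (f : R -> R) (x y z : R) :
  concave_on `[1, +oo[ f -> 1 <= x -> x <= y -> y <= z ->
  (z - y) * f x + (y - x) * f z <= (z - x) * f y.
Proof.
move=> cf x1 xy yz; have [xz|xz] := eqVneq x z.
  have -> : y = x by apply/le_anti; rewrite {1}xz yz xy.
  by rewrite xz subrr; lra.
have zx0 : 0 < z - x by rewrite subr_gt0 lt_neqAle xz (le_trans xy yz).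
have t01 : 0 <= (z - y) / (z - x) <= 1.
  by rewrite divr_ge0 ?subr_ge0 ?(le_trans xy) //= ler_pdivrMr // mul1r; lra.
have [t0 t1] := andP t01.
have := cf (Itv01 t0 t1) x z.
rewrite !convRE /= !mem_setE !in_itv /= !andbT (le_trans x1 (le_trans xy yz)) x1.
move=> /(_ isT isT).
rewrite [X in - f X](_ : _ = y); last first.
  by rewrite [LHS]convRE /= /unstable.onem; field; rewrite gt_eqF.
have -> : unstable.onem ((z - y) / (z - x)) = (y - x) / (z - x).
  by rewrite /unstable.onem; field; rewrite gt_eqF.
have -> : (z - y) / (z - x) * - f x + (y - x) / (z - x) * - f z =
    - (((z - y) * f x + (y - x) * f z) / (z - x)) by ring.
by rewrite lerN2 ler_pdivrMr // mulrC [_ * f y]mulrC.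
Qed.

(** The line is written around 2, the average degree, so that its linear term vanishes on
    summation. *)
Lemma concave_le_chord2 (R : realType) (f : R -> R) (k : nat) :
  concave_on `[1, +oo[ f -> (1 <= k)%N ->
  f k%:R <= f 2 + (k%:R - 2) * (f 2 - f 1).
Proof.
move=> cf; case: k => [|[|k]] // _; first by rewrite (_ : 1%:R = 1) //; lra.
have k2 : (2 : R) <= k.+2%:R by rewrite ler_nat.
have := @concave_on_chord R f 1 2 k.+2%:R cf.
by rewrite lexx k2 (_ : 1 <= 2); [move=> /(_ isT isT isT); lra|rewrite ler1n].
Qed.

(** For [k >= 2] the left side is [f 2 + (k - 2) s], the chord from 2 to [n - 1]; at [k = 1] it is
    [f 1]. The indicator merges both cases into one summable expression. *)
Lemma concave_ge_chord (R : realType) (f : R -> R) (n k : nat)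
    (s := (f (n%:R - 1) - f 2) / (n%:R - 3)) :
  concave_on `[1, +oo[ f -> (4 <= n)%N -> (1 <= k < n)%N ->
  f 1 + (k%:R - 1) * s + (2 <= k)%N%:R * (f 2 - f 1 - s) <= f k%:R.
Proof.
move=> cf n4 /andP[k1 kn].
have n4' : (4 : R) <= n%:R by rewrite (ler_nat R 4).
have sE : (n%:R - 3) * s = f (n%:R - 1) - f 2 by rewrite /s mulrC divfK //; lra.
have kn' : k%:R <= n%:R - 1 :> R by rewrite lerBrDr natr1 ler_nat.
move: k1; rewrite leq_eqVlt => /predU1P[<-|k2].
  by rewrite /= (_ : 1%:R = 1) //; lra.
have k2' : (2 : R) <= k%:R by rewrite (ler_nat R 2).
rewrite k2 /=.
have H : (n%:R - 1 - k%:R) * f 2 + (k%:R - 2) * f (n%:R - 1) <= (n%:R - 1 - 2) * f k%:R.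
  by apply: concave_on_chord => //; lra.
have n3 : 0 < n%:R - 3 :> R by lra.
rewrite -(ler_pM2l n3); nra.
Qed.

(** Slopes of a concave function decrease. This makes the coefficient of the indicator in the lower
    bound nonnegative. *)
Lemma concave_slope_le (R : realType) (f : R -> R) (n : nat)
    (s := (f (n%:R - 1) - f 2) / (n%:R - 3)) :
  concave_on `[1, +oo[ f -> (4 <= n)%N -> s <= f 2 - f 1.
Proof.
move=> cf n4; have n4' : (4 : R) <= n%:R by rewrite (ler_nat R 4).
rewrite /s ler_pdivrMr; last lra.
have : (n%:R - 1 - 2) * f 1 + (2 - 1) * f (n%:R - 1) <= (n%:R - 1 - 1) * f 2.
  by apply: concave_on_chord => //; lra.
lra.
Qed.

(** * Bounds on the index and their attainment *)

Lemma degree_index_le (R : realType) (f : R -> R) (G : graph) :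
  concave_on `[1, +oo[ f -> unicyclic G ->
  degree_index f G <= #|vertex G|%:R * f 2.
Proof.
move=> cf uG; apply: (@le_trans _ _
    (\sum_(u : vertex G) (f 2 + ((degree u)%:R - 2) * (f 2 - f 1)))).
  by apply: ler_sum => u _; apply: concave_le_chord2; rewrite ?degree_gt0.
rewrite big_split /= -mulr_suml sumrB -natr_sum unicyclic_sum_degree //.
rewrite !sumr_const -[f 2 *+ _]mulr_natl -[2 *+ _]mulr_natl -muln2 natrM.
by rewrite subrr mul0r addr0.
Qed.

Lemma degree_index_ge (R : realType) (f : R -> R) (G : graph)
    (n := #|vertex G|) :
  concave_on `[1, +oo[ f -> (4 <= n)%N -> unicyclic G ->
  f (n%:R - 1) + 2 * f 2 + (n%:R - 3) * f 1 <= degree_index f G.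
Proof.
move=> cf n4 uG; pose s := (f (n%:R - 1) - f 2) / (n%:R - 3).
have n4' : (4 : R) <= n%:R by rewrite (ler_nat R 4).
have sE : (n%:R - 3) * s = f (n%:R - 1) - f 2 by rewrite /s mulrC divfK //; lra.
have s_le : s <= f 2 - f 1 by exact: concave_slope_le.
have big_deg := card_unicyclic_degree_ge2 uG.
set A := [set u | _]%SET in big_deg.
apply: (@le_trans _ _ (\sum_(u : vertex G)
    (f 1 + ((degree u)%:R - 1) * s + (2 <= degree u)%N%:R * (f 2 - f 1 - s)))); last first.
  apply: ler_sum => u _; apply: concave_ge_chord => //.
  by rewrite degree_gt0 degree_lt_card.
have cardA : \sum_(u : vertex G) (2 <= degree u)%N%:R = #|A|%:R :> R.
  by rewrite -natr_sum -big_mkcond sum1dep_card.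
rewrite !big_split /= -!mulr_suml sumrB -natr_sum unicyclic_sum_degree // cardA.
rewrite !sumr_const -/n -[f 1 *+ _]mulr_natl -muln2 natrM.
have A3 : (3 : R) <= #|A|%:R by rewrite (ler_nat R 3).
(* The sum is [n f 1 + n s + #|A| (f 2 - f 1 - s)]; replacing [#|A|] by 3 only lowers it, and [sE]
   turns the result into the stated bound. *)
have : 3 * (f 2 - f 1 - s) <= #|A|%:R * (f 2 - f 1 - s).
  by rewrite ler_wpM2r // subr_ge0.
lra.
Qed.

Lemma degree_index_star_edge_graph (R : realType) (f : R -> R) m :
  degree_index f (star_edge_graph m) = f m.+2%:R + 2 * f 2 + m%:R * f 1.
Proof.
rewrite /degree_index; under eq_bigr do rewrite degree_star_edge_graph.
(* This splits off the vertices [0], [1], [2]; the other [m] are leaves. *)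
rewrite !big_ord_recl /=.
by rewrite sumr_const card_ord -[f 1 *+ m]mulr_natl; ring.
Qed.

Theorem theorem3p5 (R : realType) (n : nat) (f : R -> R)
    (n_ge4 : (4 <= n)%N) (f_concave : concave_on `[1, +oo[ f) :
  [/\ forall G : graph, #|vertex G| = n -> unicyclic G ->
        f (n%:R - 1) + 2 * f 2 + (n%:R - 3) * f 1 <= degree_index f G
        /\ degree_index f G <= n%:R * f 2,
      exists G : graph, [/\ #|vertex G| = n, unicyclic G &
        degree_index f G = f (n%:R - 1) + 2 * f 2 + (n%:R - 3) * f 1] &
      exists G : graph, [/\ #|vertex G| = n, unicyclic G &
        degree_index f G = n%:R * f 2]].
Proof.
split.
- move=> G cardG uG; split; last by rewrite -cardG; exact: degree_index_le.
  by move: n_ge4; rewrite -cardG => n4; exact: degree_index_ge.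
- case: n n_ge4 => [|[|[|m]]] // _; exists (star_edge_graph m).
  split; [exact: card_ord|exact: unicyclic_star_edge_graph|].
  rewrite degree_index_star_edge_graph.
  by rewrite -{1}[m.+3%:R]natr1 addrK -[m.+3]addn3 natrD addrK.
case: n n_ge4 => [|[|[|m]]] // _; exists (cycle_graph m).
split; [exact: card_ord|exact: unicyclic_cycle_graph|].
rewrite /degree_index; under eq_bigr do rewrite degree_cycle_graph.
by rewrite sumr_const card_ord mulr_natl.
Qed.
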